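(* Let $p<q$ be odd primes. Then $$\mathrm{B}(pq^4)=\max\{p\,\mathrm{H}(\Phi_{pq}(x)\Phi_{pq^{2}}(x)\Phi_{q^{3}}(x)),\ p\,\mathrm{H}(\Phi_{pq}(x)\Phi_{q^{2}}(x))\}$$ and $$\mathrm{B}(pq^5)=p\,\bigl(\mathrm{H}(\Phi_{pq}(x)\Phi_{q^{2}}(x))\bigr)^2.$$
   Context: $\Phi_n(x)$ denotes the $n$-th cyclotomic polynomial. The height $\mathrm{H}(f)$ of a polynomial $f\in\mathbb{Z}[x]$ is the largest absolute value of its coefficients. For a positive integer $n$, $\mathrm{B}(n):=\max\{\mathrm{H}(f) : f\in\mathbb{Z}[x],\ f \mid x^{n}-1\}$. *)

(* Defs.v *)
From HB Require Import structures.
From mathcomp Require Import all_boot all_order all_algebra all_field.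
From mathcomp Require Import boolp classical_sets.

Set Implicit Arguments.
Unset Strict Implicit.
Unset Printing Implicit Defensive.
Import Order.TTheory GRing.Theory Num.Theory.

Local Open Scope classical_set_scope.
Local Open Scope ring_scope.

Definition height (f : {poly int}) : nat := (\max_(i < size f) `|(f`_i)%R|)%N.

(* Divisibility in Z[x] is spelled out because [%|] on {poly int} is
   pseudo-divisibility, for which every nonzero constant divides everything. *)
Definition dvdZX (f g : {poly int}) : Prop := exists h : {poly int}, g = h * f.

Definition divisor_heights (n : nat) : set nat :=
  [set height f | f in [set f | dvdZX f ('X^n - 1)]].

Definition is_maximum (A : set nat) (m : nat) : Prop :=
  A m /\ forall k, A k -> (k <= m)%N.

(* By [BP] below the maximum exists for every n > 0, so the default value 0 of
   [xget] is used only for n = 0. *)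
Definition B (n : nat) : nat := xget 0%N (is_maximum (divisor_heights n)).

Lemma norm_coef_prod_XsubC (s : seq algC) i :
  {in s, forall z, `|z| <= 1} ->
  `|(\prod_(z <- s) ('X - z%:P))`_i| <= 2 ^+ size s.
Proof.
elim: s i => [|z s IHs] i s_le1.
  by rewrite big_nil coef1 expr0; case: (i == 0)%N; rewrite ?normr1 ?normr0.
have {}IHs j : `|(\prod_(z <- s) ('X - z%:P))`_j| <= 2 ^+ size s.
  by apply: IHs => y ys; apply: s_le1; rewrite inE ys orbT.
rewrite big_cons mulrBl coefB coefXM coefCM /= exprS mulr_natl mulr2n.
apply: le_trans (ler_normB _ _) _; apply: lerD.
  by case: ifP => // _; rewrite normr0 exprn_ge0.
rewrite normrM; apply: le_trans (IHs i).
by rewrite ler_piMl // s_le1 // mem_head.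
Qed.

Lemma height_divisor_bound n f :
  (0 < n)%N -> dvdZX f ('X^n - 1) -> (height f <= 2 ^ n)%N.
Proof.
move=> n_gt0 [g Dfg]; apply/bigmax_leqP => i _.
have lead1 : `|lead_coef f| = 1 :> int.
  have: lead_coef g * lead_coef f = 1.
    by rewrite -lead_coefM -Dfg; apply/monicP/monicXnsubC.
  by move/(congr1 (fun x => `|x|%N)); rewrite abszM => /eqP;
    rewrite muln_eq1 => /andP[_ /eqP l1]; rewrite -abszE l1.
have [z prim_z] := C_prim_root_exists n_gt0.
pose toC := map_poly (intr : int -> algC).
pose rs := [seq z ^+ val k | k <- enum 'I_n].
have Drs : toC ('X^n - 1) = \prod_(y <- rs) ('X - y%:P).
  rewrite /toC rmorphB rmorph1 /= map_polyXn -(factor_Xn_sub_1 prim_z).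
  by rewrite big_map big_enum /= big_mkord.
have rs_le1 : {in rs, forall y, `|y| <= 1}.
  move=> _ /mapP[k _ ->]; rewrite normrX.
  have /eqP: `|z| ^+ n = 1 by rewrite -normrX (prim_expr_order prim_z) normr1.
  by rewrite pexpr_eq1 // => /eqP ->; rewrite expr1n.
have: toC f %| \prod_(y <- rs) ('X - y%:P).
  by rewrite -Drs Dfg /toC rmorphM dvdp_mull.
case/dvdp_prod_XsubC => m; set h := \prod_(_ <- _) _ => eq_fh.
have h_monic : h \is monic by apply: monic_prod_XsubC.
have Df : toC f = lead_coef (toC f) *: h.
  by have := eqpfP eq_fh; rewrite (monicP h_monic) divr1.
rewrite -(ler_nat algC) natrX natr_absz intr_norm.
have ->: (f`_i)%:~R = (toC f)`_i :> algC by rewrite coef_map.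
rewrite Df coefZ normrM (lead_coef_map_inj intr_inj) //.
rewrite -intr_norm lead1 mul1r.
apply: le_trans (norm_coef_prod_XsubC _ _) _.
  by move=> y /mem_mask; apply: rs_le1.
rewrite ler_weXn2l ?ler1n //.
by rewrite (leq_trans (size_subseq (mask_subseq m rs))) // size_map size_enum_ord.
Qed.

Lemma BP n : (0 < n)%N -> is_maximum (divisor_heights n) (B n).
Proof.
move=> n_gt0; rewrite /B; apply: xgetPex.
have exA : exists k, `[< divisor_heights n k >].
  by exists (height 1); apply/asboolP; exists 1 => //=; exists ('X^n - 1);
    rewrite mulr1.
have ubA k : `[< divisor_heights n k >] -> (k <= 2 ^ n)%N.
  by move=> /asboolP[f /= fP <-]; apply: height_divisor_bound.
case: (ex_maxnP exA ubA) => m /asboolP Am m_max.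
by exists m; split=> // k /asboolP /m_max.
Qed.

(* Main.v *)
Require Import Defs.
From mathcomp Require Import all_boot all_order all_algebra all_field.
From mathcomp Require Import zify ring.

(** Up to sign, a divisor of X^(p q^b) - 1 is f0(X) times a product of
    letters g_i(X^(q^(i-1))), 1 <= i <= b, where f0 divides (X - 1) Phi_p and
    each g_i is 1, Phi_q, Phi_pq or Phi_q Phi_pq.  The coefficients of
    P(X) G(X^q) with index congruent to r mod q are those of P_r G, where P_r
    is the decimation of P along r + q N; so heights can be computed letter by
    letter.  Phi_q and Phi_q Phi_pq decimate to monomials, and multiplication
    by Phi_pq followed by decimation maps blocks +-(X^a + ... + X^(b-1)) with
    0 <= a <= b <= p to such blocks, because
    (X^q - 1) Phi_pq = (X - 1) sum_(i < q) X^(p i).  A block of length l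
    multiplies heights by at most l, with equality when the next letter is
    Phi_q.  Put H = H(Phi_pq Phi_(q^2)).  Two complementary blocks have total
    length p, whence p <= H^2; it follows that words of 3 letters have height at
    most max(H(Phi_pq Phi_(p q^2) Phi_(q^3)), H) and words of 4 letters height
    at most H^2.  Finally f0 and the first letter together contribute at most a
    factor p, attained by Phi_p Phi_q. *)

Set Implicit Arguments.
Unset Strict Implicit.
Unset Printing Implicit Defensive.
Import Order.TTheory GRing.Theory Num.Theory.

Local Open Scope ring_scope.

Implicit Types (f g P G : {poly int}).

(** * Heights of sums and of products with monomials *)

Lemma coef_height P i : (`|(P`_i)%R| <= height P)%N.
Proof.
case: (ltnP i (size P)) => [lt_iP | le_Pi]; last by rewrite nth_default.
exact: (leq_bigmax (Ordinal lt_iP)).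
Qed.

Lemma height_leP P N : (forall i, `|(P`_i)%R| <= N)%N -> (height P <= N)%N.
Proof. by move=> leN; apply/bigmax_leqP => i _. Qed.

Lemma height1 : height 1 = 1%N.
Proof. by rewrite /height size_poly1 big_ord1 coef1. Qed.

Lemma heightN P : height (- P) = height P.
Proof. by rewrite /height size_polyN; apply: eq_bigr => i _; rewrite coefN abszN. Qed.

Lemma heightD P G : (height (P + G) <= height P + height G)%N.
Proof.
apply: height_leP => i; rewrite coefD.
by have := coef_height P i; have := coef_height G i; lia.
Qed.

Lemma heightXnM n P : (height ('X^n * P) <= height P)%N.
Proof.
apply: height_leP => i; rewrite coefXnM; case: ifP => // _.
exact: coef_height.
Qed.

Lemma height_sum n (F : nat -> {poly int}) N :
  (forall i, (i < n)%N -> (height (F i) <= N)%N) ->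
  (height (\sum_(i < n) F i) <= n * N)%N.
Proof.
elim: n => [|n IHn] leN.
  by rewrite big_ord0; apply: height_leP => i; rewrite coef0.
rewrite big_ord_recr /= mulSn addnC; apply: leq_trans (heightD _ _) _.
by rewrite leq_add ?IHn ?leN // => i lt_in; apply: leN; apply: ltnW.
Qed.

Definition geom n : {poly int} := \sum_(i < n) 'X^i.

Lemma geomE n : ('X - 1) * geom n = 'X^n - 1.
Proof. by rewrite -subrX1. Qed.

Lemma coef_geom n i : (geom n)`_i = (i < n)%N%:R.
Proof.
rewrite coef_sum; case: (ltnP i n) => [lt_in | le_ni].
  rewrite (bigD1 (Ordinal lt_in)) //= coefXn eqxx big1 ?addr0 // => j ne_ji.
  by rewrite coefXn; case: eqP => // eq_ij; case/eqP: ne_ji; apply: val_inj.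
rewrite big1 // => j _; rewrite coefXn; case: eqP => // eq_ij.
by have := ltn_ord j; rewrite -eq_ij ltnNge le_ni.
Qed.

Lemma height_geomM n P : (height (geom n * P) <= n * height P)%N.
Proof.
rewrite mulr_suml; apply: (@height_sum n (fun i => 'X^i * P)) => i _.
exact: heightXnM.
Qed.

(** * Decimation along a residue class *)

Section Decimation.

Variables (q : nat) (q_gt0 : (0 < q)%N).

(** When q > 0, k <= r + q k, so cutting off at [size P] loses no nonzero coefficient. *)
Definition dec r P : {poly int} := \poly_(k < size P) P`_(r + q * k).

Lemma coef_dec r P k : (dec r P)`_k = P`_(r + q * k).
Proof.
rewrite coef_poly; case: ltnP => // le_Pk; rewrite nth_default //.
by apply: leq_trans le_Pk _; rewrite (leq_trans (leq_pmull _ q_gt0)) ?leq_addl.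
Qed.

Lemma decD r P G : dec r (P + G) = dec r P + dec r G.
Proof. by apply/polyP => k; rewrite !(coef_dec, coefD). Qed.

Lemma decN r P : dec r (- P) = - dec r P.
Proof. by apply/polyP => k; rewrite !(coef_dec, coefN). Qed.

Lemma decC_M r c P : dec r (c%:P * P) = c%:P * dec r P.
Proof. by apply/polyP => k; rewrite !(coef_dec, coefCM). Qed.

Lemma decXqM r P : (r < q)%N -> dec r (P * 'X^q) = dec r P * 'X.
Proof.
move=> lt_rq; apply/polyP => -[|k]; rewrite coef_dec coefMX coefMXn /=.
  by rewrite muln0 addn0 lt_rq.
rewrite coef_dec mulnS addnCA ltnNge leq_addr /=; congr _`_ _; lia.
Qed.

(** A factor that is a polynomial in X^q does not mix residue classes of exponents; Horner induction
    on [G] reduces this to a single factor X^q. *)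
Lemma dec_comp r P G : (r < q)%N -> dec r (P * (G \Po 'X^q)) = dec r P * G.
Proof.
move=> lt_rq; elim/poly_ind: G => [|G c IHG].
  by rewrite comp_poly0 !mulr0; apply/polyP => k; rewrite coef_dec !coef0.
rewrite comp_polyD comp_polyM comp_polyX comp_polyC !mulrDr decD.
by rewrite [P * (_ * _)]mulrA decXqM // IHG (mulrC P) decC_M -mulrA (mulrC c%:P).
Qed.

Lemma height_dec r P : (height (dec r P) <= height P)%N.
Proof. by apply: height_leP => k; rewrite coef_dec coef_height. Qed.

(** Every coefficient of the product belongs to exactly one residue class mod q. *)
Lemma height_dec_le P G N :
    (forall r, (r < q)%N -> (height (dec r P * G) <= N)%N) ->
  (height (P * (G \Po 'X^q)) <= N)%N.
Proof.
move=> leN; apply: height_leP => i; have lt_rq := ltn_pmod i q_gt0.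
rewrite (divn_eq i q) addnC mulnC -coef_dec dec_comp //.
exact: leq_trans (coef_height _ _) (leN _ lt_rq).
Qed.

Lemma height_dec_ge r P G : (r < q)%N ->
  (height (dec r P * G) <= height (P * (G \Po 'X^q)))%N.
Proof. by move=> lt_rq; rewrite -dec_comp // height_dec. Qed.

End Decimation.

(** * Divisors in Z[X] of products of cyclotomic polynomials *)

Section DivisorsOfCyclotomicProducts.

Let intC : int -> algC := intr.

(** Division by the monic ['Phi_d] stays in Z[X]. The remainder vanishes at [z] and has smaller
    degree than the minimal polynomial of [z] over Q, so it is 0. *)
Lemma Cyclotomic_dvd d z f : d.-primitive_root z ->
  root (map_poly intC f) z -> exists f', f = f' * 'Phi_d.
Proof.
move=> prim_z fz0; have mPhi := Cyclotomic_monic d.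
pose r := Pdiv.Ring.rmodp f 'Phi_d.
have Df := Pdiv.RingMonic.rdivp_eq mPhi f; rewrite -/r in Df.
have Phi_z : map_poly intC 'Phi_d = minCpoly z.
  by rewrite (minCpoly_cyclotomic prim_z) -(Cintr_Cyclotomic prim_z).
exists (Pdiv.Ring.rdivp f 'Phi_d); rewrite [LHS]Df.
suff -> : r = 0 by rewrite addr0.
have rz0 : root (map_poly intC r) z.
  move: fz0; rewrite Df rmorphD rmorphM /= Phi_z /root hornerD hornerM.
  by rewrite (rootP (root_minCpoly z)) mulr0 add0r.
have [m [Dm _ dvdm]] := minCpolyP z.
pose rQ := map_poly (intr : int -> rat) r.
have DrQ : map_poly (ratr : rat -> algC) rQ = map_poly intC r.
  by apply/polyP => i; rewrite !coef_map_id0 ?rmorph0 // ratr_int.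
have m_dvd_r : m %| rQ by rewrite -dvdm DrQ.
have sz_rQ : size rQ = size r by rewrite size_map_inj_poly //; apply: intr_inj.
have sz_m : size m = size 'Phi_d.
  have <- : size (map_poly intC 'Phi_d) = size 'Phi_d.
    by rewrite size_map_inj_poly //; apply: intr_inj.
  by rewrite Phi_z Dm size_map_poly.
apply/eqP; rewrite -size_poly_eq0 -sz_rQ size_poly_eq0.
apply/negPn/negP => /dvdp_leq /(_ m_dvd_r); apply/negP.
rewrite -ltnNge sz_rQ sz_m; apply: Pdiv.Ring.ltn_rmodpN0.
exact: monic_neq0.
Qed.

(** ['Phi_d] is prime in Z[X]: a primitive d-th root of unity is a root of [f] or of [g]. *)
Lemma Cyclotomic_dvdM d f g K : (0 < d)%N -> f * g = 'Phi_d * K ->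
    (exists2 f', f = f' * 'Phi_d & f' * g = K)
 \/ (exists2 g', g = g' * 'Phi_d & f * g' = K).
Proof.
move=> d_gt0 Dfg; have [z prim_z] := C_prim_root_exists d_gt0.
have Phi_neq0 := monic_neq0 (Cyclotomic_monic d).
have : root (map_poly intC (f * g)) z.
  rewrite Dfg rmorphM rootM /= /intC (Cintr_Cyclotomic prim_z).
  by rewrite root_cyclotomic // prim_z.
rewrite rmorphM rootM => /orP[] /(Cyclotomic_dvd prim_z)[h Dh]; [left|right].
  by exists h => //; apply: (mulIf Phi_neq0); rewrite mulrAC -Dh Dfg mulrC.
by exists h => //; apply: (mulIf Phi_neq0); rewrite -mulrA -Dh Dfg mulrC.
Qed.

Lemma poly_int_unit f g : f * g = 1 -> f = 1 \/ f = -1.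
Proof.
move=> fg1; have /size_poly1P[c _ Df] : size f == 1%N.
  have := size_mul_eq1 f g; rewrite fg1 size_poly1 eqxx.
  by case/esym/andP.
have : c * lead_coef g = 1.
  by rewrite -(lead_coefC c) -Df -lead_coefM fg1 lead_coef1.
move/(congr1 absz); rewrite abszM => /eqP; rewrite muln_eq1 => /andP[/eqP c1 _].
by rewrite Df; case: (intP c) c1 => [|n|n] // [->]; [left | right; rewrite polyCN].
Qed.

End DivisorsOfCyclotomicProducts.

(** * Cyclotomic polynomials of index q^i and p q^i, and words in them *)

Section CyclotomicPrimePowers.

(** A divisor of m q^(i+1) falls in the second list exactly when q^(i+1) divides it. *)
Lemma perm_divisorsM_pfactor m q i : prime q -> coprime m q -> (0 < m)%N ->
  perm_eq (divisors (m * q ^ i.+1))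
    (divisors (m * q ^ i) ++ [seq (d * q ^ i.+1)%N | d <- divisors m]).
Proof.
move=> q_prime co_mq m_gt0; have q_gt0 := prime_gt0 q_prime.
have mq_gt0 j : (0 < m * q ^ j)%N by rewrite muln_gt0 m_gt0 expn_gt0 q_gt0.
apply: uniq_perm; first exact: divisors_uniq.
  rewrite cat_uniq divisors_uniq map_inj_uniq ?divisors_uniq ?andbT /=.
    apply/hasPn => _ /mapP[d _ ->]; rewrite -dvdn_divisors //.
    apply/negP => dvd_q; have: (q ^ i.+1 %| m * q ^ i)%N.
      by apply: dvdn_trans dvd_q; apply: dvdn_mull.
    rewrite Gauss_dvdr ?coprimeXl 1?coprime_sym // dvdn_Pexp2l ?prime_gt1 //.
    by rewrite ltnn.
  by move=> d e /eqP; rewrite eqn_pmul2r ?expn_gt0 ?q_gt0 // => /eqP.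
move=> d; rewrite mem_cat -!dvdn_divisors //; apply/idP/orP.
  (* The gcd is some q^j; the cofactor of q^j in [d] is coprime to q^(i+1-j), hence divides [m]. *)
  move=> dvd_d; have := dvdn_gcdr d (q ^ i.+1).
  case/(dvdn_pfactor _ _ q_prime) => j le_ji Dg.
  have /dvdnP[e De] : (q ^ j %| d)%N by rewrite -Dg dvdn_gcdl.
  have e_dvd_m : (e %| m)%N.
    have qj_gt0 : (0 < q ^ j)%N by rewrite expn_gt0 q_gt0.
    have : coprime e (q ^ (i.+1 - j)).
      rewrite /coprime -(eqn_pmul2r qj_gt0) mul1n muln_gcdl -De -expnD.
      by rewrite subnK // Dg.
    move/Gauss_dvdl <-; rewrite -(dvdn_pmul2r qj_gt0) -De -mulnA -expnD.
    by rewrite subnK.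
  move: le_ji; rewrite leq_eqVlt => /orP[/eqP Dj | lt_ji].
    by right; rewrite De Dj; apply: map_f; rewrite -dvdn_divisors.
  by left; rewrite De dvdn_mul // dvdn_exp2l.
case=> [dvd_d | /mapP[e]].
  by apply: dvdn_trans dvd_d _; rewrite expnS mulnCA dvdn_mull.
by rewrite -dvdn_divisors // => dvd_e ->; rewrite dvdn_mul.
Qed.

Lemma Xn_sub1_pfactor m q i : prime q -> coprime m q -> (0 < m)%N ->
  'X^(m * q ^ i.+1) - 1 =
    ('X^(m * q ^ i) - 1) * \prod_(d <- divisors m) 'Phi_(d * q ^ i.+1).
Proof.
move=> q_prime co_mq m_gt0; have q_gt0 := prime_gt0 q_prime.
rewrite -!prod_Cyclotomic ?muln_gt0 ?m_gt0 ?expn_gt0 ?q_gt0 //.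
by rewrite (perm_big _ (perm_divisorsM_pfactor i q_prime co_mq m_gt0)) big_cat big_map.
Qed.

Lemma Cyclotomic1 : 'Phi_1 = 'X - 1.
Proof. by have := @prod_Cyclotomic 1 isT; rewrite expr1 big_seq1. Qed.

Lemma Xn_sub1_neq0 n : (0 < n)%N -> 'X^n - 1 != 0 :> {poly int}.
Proof. by move=> n_gt0; apply: monic_neq0 (monicXnsubC _ n_gt0). Qed.

Lemma Xn_sub1_comp n k : ('X^n - 1) \Po 'X^k = 'X^(k * n) - 1 :> {poly int}.
Proof.
by rewrite rmorphB rmorph1 rmorphXn /= comp_polyX -exprM.
Qed.

Lemma Xq_sub1 q i : prime q -> 'X^(q ^ i.+1) - 1 = ('X^(q ^ i) - 1) * 'Phi_(q ^ i.+1).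
Proof.
move=> q_prime; have := @Xn_sub1_pfactor 1 q i q_prime (coprime1n _) isT.
by rewrite !mul1n big_seq1 mul1n.
Qed.

Lemma Cyclotomic_prime q : prime q -> 'Phi_q = geom q.
Proof.
move=> q_prime; have := Xq_sub1 0 q_prime; rewrite expn0 expn1 -geomE.
by move/(mulfI (Xn_sub1_neq0 (n := 1) isT)).
Qed.

(** Multiplied by X^(q^(i+1)) - 1, both sides become X^(q^(i+2)) - 1. The exponent starts at 2
    because Phi_1(X^q) is Phi_1 Phi_q rather than Phi_q. *)
Lemma Cyclotomic_prime_exp q i : prime q ->
  'Phi_(q ^ i.+2) = 'Phi_(q ^ i.+1) \Po 'X^q.
Proof.
move=> q_prime; have q_gt0 := prime_gt0 q_prime.
have /Xn_sub1_neq0 X_neq0 : (0 < q ^ i.+1)%N by rewrite expn_gt0 q_gt0.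
apply: (mulfI X_neq0); rewrite -Xq_sub1 // [in LHS]expnS -Xn_sub1_comp.
by rewrite [in LHS]Xq_sub1 // rmorphM /= Xn_sub1_comp -expnS.
Qed.

Variables (p q : nat).
Hypotheses (p_prime : prime p) (q_prime : prime q) (ne_pq : p != q).

Let p_gt0 := prime_gt0 p_prime.
Let q_gt0 := prime_gt0 q_prime.

Lemma Xpq_sub1 i :
  'X^(p * q ^ i.+1) - 1 =
    ('X^(p * q ^ i) - 1) * ('Phi_(q ^ i.+1) * 'Phi_(p * q ^ i.+1)).
Proof.
have co_pq : coprime p q by rewrite prime_coprime // dvdn_prime2.
rewrite Xn_sub1_pfactor //; congr (_ * _).
have := @perm_divisorsM_pfactor 1 p 0 p_prime (coprime1n _) isT.
rewrite !mul1n expn1 expn0 /= mul1n => perm_div.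
by rewrite (perm_big _ perm_div) big_cons big_seq1 mul1n.
Qed.

Lemma Cyclotomic_pq_exp i :
  'Phi_(p * q ^ i.+2) = 'Phi_(p * q ^ i.+1) \Po 'X^q.
Proof.
have /Xn_sub1_neq0 X_neq0 : (0 < p * q ^ i.+1)%N.
  by rewrite muln_gt0 p_gt0 expn_gt0 q_gt0.
have Phi_neq0 := monic_neq0 (Cyclotomic_monic (q ^ i.+2)).
apply: (mulfI Phi_neq0); apply: (mulfI X_neq0); rewrite -Xpq_sub1.
rewrite Cyclotomic_prime_exp // [in LHS]expnS mulnCA -Xn_sub1_comp.
by rewrite [in LHS]Xpq_sub1 !rmorphM /= Xn_sub1_comp mulnCA -expnS.
Qed.

(** Both sides are (X^(pq) - 1) / (X^p - 1). *)
Lemma Cyclotomic_q_pq : 'Phi_q * 'Phi_(p * q) = geom q \Po 'X^p.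
Proof.
apply: (mulfI (Xn_sub1_neq0 p_gt0)).
have := Xpq_sub1 0; rewrite expn0 !expn1 muln1 => <-.
by rewrite -Xn_sub1_comp -geomE rmorphM /= rmorphB rmorph1 /= comp_polyX.
Qed.

(** Both sides are (X^(pq) - 1) / (X^q - 1). *)
Lemma Cyclotomic_p_pq : 'Phi_p * 'Phi_(p * q) = geom p \Po 'X^q.
Proof.
apply: (mulfI (Xn_sub1_neq0 q_gt0)).
have := Xpq_sub1 0; rewrite expn0 !expn1 muln1 => Dpq.
have Xp : 'X^p - 1 = ('X - 1) * 'Phi_p by rewrite Cyclotomic_prime // geomE.
have Xq : 'X^q - 1 = ('X - 1) * 'Phi_q by rewrite Cyclotomic_prime // geomE.
have -> : ('X^q - 1) * (geom p \Po 'X^q) = 'X^(p * q) - 1.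
  by rewrite mulnC -Xn_sub1_comp -(geomE p) rmorphM /= rmorphB rmorph1 /= comp_polyX.
by rewrite Dpq Xp Xq; ring.
Qed.

(* The i-th letter (a, c) of [w] stands for
   [Phi_(q^(j+i)) ^ a * Phi_(p q^(j+i)) ^ c]. *)
Fixpoint cyc_word j (w : seq (bool * bool)) : {poly int} :=
  if w is (a, c) :: w' then
    'Phi_(q ^ j) ^+ a * 'Phi_(p * q ^ j) ^+ c * cyc_word j.+1 w'
  else 1.

Lemma cyc_word_comp j w : cyc_word j.+2 w = cyc_word j.+1 w \Po 'X^q.
Proof.
elim: w j => [|[a c] w IHw] j; first by rewrite /= rmorph1.
rewrite [LHS]/= [cyc_word j.+1 _]/= IHw Cyclotomic_prime_exp // Cyclotomic_pq_exp.
by rewrite !rmorphM !rmorphXn.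
Qed.

Lemma Xn_sub1_cyc_word b : 'X^(p * q ^ b) - 1 = cyc_word 0 (nseq b.+1 (true, true)).
Proof.
suff cyc_nseq j : cyc_word 0 (nseq j.+1 (true, true)) = 'X^(p * q ^ j) - 1 by [].
have cyc_rcons w i x :
    cyc_word i (rcons w x) = cyc_word i w * cyc_word (i + size w) [:: x].
  elim: w i => [|[a c] w IHw] i; first by rewrite addn0 mul1r.
  by rewrite [LHS]/= IHw [in RHS]/= addnS addSn !mulrA.
elim: j => [|j IHj].
  rewrite /= !expn0 !muln1 !expr1 mulr1 Cyclotomic1 Cyclotomic_prime //.
  by rewrite geomE.
have -> : nseq j.+2 (true, true) = rcons (nseq j.+1 (true, true)) (true, true).
  by rewrite -[RHS]cats1 -[[:: _]]/(nseq 1 _) -nseqD addn1.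
by rewrite cyc_rcons IHj size_nseq add0n Xpq_sub1 /= !expr1 mulr1.
Qed.

(** Each cyclotomic factor is prime, so it goes to [f] or to [g]; what remains of [f] at the end is
    a unit, whence the sign. *)
Lemma cyc_word_divisor j b f g : f * g = cyc_word j (nseq b (true, true)) ->
  exists2 w, size w = b & f = cyc_word j w \/ f = - cyc_word j w.
Proof.
elim: b j f g => [|b IHb] j f g /=.
  by move/poly_int_unit => [] ->; exists [::] => //; [left | right].
have qj_gt0 : (0 < q ^ j)%N by rewrite expn_gt0 q_gt0.
have pqj_gt0 : (0 < p * q ^ j)%N by rewrite muln_gt0 p_gt0.
rewrite !expr1 -mulrA => /(Cyclotomic_dvdM qj_gt0) Dfg.
have [a [f1 [g1 [Df Dfg1]]]] : exists a : bool, exists f1 g1, f = f1 * 'Phi_(q ^ j) ^+ a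
    /\ f1 * g1 = 'Phi_(p * q ^ j) * cyc_word j.+1 (nseq b (true, true)).
  case: Dfg => [[f1 Df Dfg1] | [g1 Dg Dfg1]].
    by exists true, f1, g; rewrite expr1.
  by exists false, f, g1; rewrite expr0 mulr1.
have [c [f2 [g2 [Df1 Dfg2]]]] : exists c : bool, exists f2 g2,
    f1 = f2 * 'Phi_(p * q ^ j) ^+ c
    /\ f2 * g2 = cyc_word j.+1 (nseq b (true, true)).
  case: (Cyclotomic_dvdM pqj_gt0 Dfg1) => [[f2 Df1 Dfg2] | [g2 Dg Dfg2]].
    by exists true, f2, g1; rewrite expr1.
  by exists false, f1, g2; rewrite expr0 mulr1.
have [w sz_w Dw] := IHb _ _ _ Dfg2.
exists ((a, c) :: w); first by rewrite /= sz_w.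
by rewrite Df Df1; case: Dw => -> /=; [left | right]; ring.
Qed.

Lemma cyc_word_dvd j w : exists g, cyc_word j (nseq (size w) (true, true)) = g * cyc_word j w.
Proof.
elim: w j => [|[a c] w IHw] j /=; first by exists 1; rewrite mulr1.
have [g ->] := IHw j.+1.
(* The cofactor is spelled by the complementary letters. *)
exists ('Phi_(q ^ j) ^+ (~~ a) * 'Phi_(p * q ^ j) ^+ (~~ c) * g).
by case: a; case: c; rewrite /= !(expr0, expr1); ring.
Qed.

End CyclotomicPrimePowers.

(** * Blocks of consecutive monomials *)

(* (X^b - X^a) / (X - 1) *)
Definition gap a b : {poly int} :=
  if (a <= b)%N then 'X^a * geom (b - a) else - ('X^b * geom (a - b)).

(** One of the truncated differences is 0, so this is |a - b|, the number of monomials in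
    [gap a b]. *)
Definition dist a b := ((a - b) + (b - a))%N.

Lemma gapE a b : ('X - 1) * gap a b = 'X^b - 'X^a.
Proof.
rewrite /gap; case: ifP => le_ab; rewrite ?mulrN mulrCA geomE mulrBr mulr1 -exprD.
  by rewrite subnKC.
by rewrite subnKC ?opprB // ltnW // ltnNge le_ab.
Qed.

Lemma XsubC1_neq0 : 'X - 1 != 0 :> {poly int}.
Proof. by rewrite -polyC1 polyXsubC_eq0. Qed.

Lemma gap01 : gap 0 1 = 1.
Proof. by apply: (mulfI XsubC1_neq0); rewrite gapE mulr1. Qed.

Lemma gap0n n : gap 0 n = geom n.
Proof. by rewrite /gap /= subn0 mul1r. Qed.

Lemma height_gapM a b G : (height (gap a b * G) <= dist a b * height G)%N.
Proof.
have le_geom n m : (height ('X^m * geom n * G) <= n * height G)%N.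
  by rewrite -mulrA (leq_trans (heightXnM _ _)) ?height_geomM.
rewrite /gap /dist; case: ifP => le_ab; rewrite ?mulNr ?heightN.
  by rewrite (leq_trans (le_geom _ _)) // leq_mul2r leq_addl orbT.
by rewrite (leq_trans (le_geom _ _)) // leq_mul2r leq_addr orbT.
Qed.

Lemma height_gap a b : (height (gap a b) <= 1)%N.
Proof.
have le_geom n m : (height ('X^m * geom n) <= 1)%N.
  rewrite (leq_trans (heightXnM _ _)) //; apply: height_leP => i.
  by rewrite coef_geom; case: (_ < _)%N.
by rewrite /gap; case: ifP; rewrite ?heightN.
Qed.

(** All exponents of the block are below q, so each of its monomials contributes the same sign to
    the coefficient of X^(q-1) in [gap a b * geom q]. The degree stays below 2q - 1, so along the
    class q - 1 only this constant, of absolute value [dist a b], remains. *)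
Lemma height_gap_geom_ge q a b G : (0 < q)%N -> (a <= q)%N -> (b <= q)%N ->
  (dist a b * height G <= height (gap a b * geom q * (G \Po 'X^q)))%N.
Proof.
move=> q_gt0 le_aq le_bq.
have dec_geom n m : (m + n <= q)%N -> dec q q.-1 ('X^m * geom n * geom q) = n%:R%:P.
  move=> le_q; apply/polyP => k; rewrite coef_dec // coefC -mulrA coefXnM.
  rewrite mulr_suml coef_sum.
  under eq_bigr do rewrite coefXnM coef_geom.
  case: ifP => [lt_m | _]; first by case: k lt_m => // lt_m; have -> : n = 0%N by lia.
  case: k => [|k] /=.
    rewrite (eq_bigr (fun=> 1)) ?sumr_const ?card_ord // => i _.
    have lt_in := ltn_ord i; rewrite ifF; last by apply/negbTE; lia.
    by rewrite (_ : _ < _)%N //; lia.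
  rewrite big1 // => i _; have lt_in := ltn_ord i.
  by case: ifP => // _; case: ltnP => //; nia.
have heightC_M (n : nat) P : height (n%:R%:P * P) = (n * height P)%N.
  apply/eqP; rewrite eqn_leq; apply/andP; split.
    apply: height_leP => i; rewrite coefCM abszM natz absz_nat.
    by rewrite leq_mul2l coef_height orbT.
  case: n => // n; rewrite mulnC -leq_divRL //; apply: height_leP => i.
  rewrite leq_divRL // mulnC; apply: leq_trans (coef_height _ i).
  by rewrite coefCM abszM natz absz_nat.
have lt_q : (q.-1 < q)%N by rewrite ltn_predL.
apply: leq_trans (height_dec_ge q_gt0 _ _ lt_q).
rewrite /gap /dist; case: ifP => le_ab.
  rewrite dec_geom ?subnKC // heightC_M leq_mul2r.
  by move/eqP: (le_ab) => ->; rewrite leqnn orbT.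
rewrite mulNr decN // dec_geom ?subnKC //; last by lia.
by rewrite mulNr heightN heightC_M leq_mul2r; apply/orP; right; lia.
Qed.

(** * Decimation of blocks and words, letter by letter *)

Section Words.

Variables (p q : nat).
Hypotheses (p_prime : prime p) (q_prime : prime q).
Hypotheses (p_gt2 : (2 < p)%N) (p_lt_q : (p < q)%N).

Let p_gt0 : (0 < p)%N := prime_gt0 p_prime.
Let q_gt0 : (0 < q)%N := prime_gt0 q_prime.
Let ne_pq : p != q. Proof. by rewrite neq_ltn p_lt_q. Qed.
Let co_pq : coprime p q. Proof. by rewrite prime_coprime // dvdn_prime2. Qed.

(* [m + p * idx r m] is congruent to [r] mod [q], so that [slot r m] is the
   exponent of the monomial along [r] in [X^m * sum_(i < q) X^(p i)]. *)
Definition idx r m := (((r + q.-1 * m) * (egcdn p q).1) %% q)%N.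
Definition slot r m := ((m + p * idx r m) %/ q)%N.

Lemma idx_lt r m : (idx r m < q)%N.
Proof. exact: ltn_pmod. Qed.

(** [(egcdn p q).1] inverts p mod q and [q.-1 * m] stands for -m, so [p * idx r m] is r - m mod
    q. *)
Lemma slotE r m : (r < q)%N -> (m + p * idx r m = r + q * slot r m)%N.
Proof.
move=> lt_rq; rewrite [LHS](divn_eq _ q) -/(slot r m).
rewrite [(slot _ _ * q)%N]mulnC [LHS]addnC; congr (_ + _)%N.
rewrite -[RHS](modn_small lt_rq) /idx -[LHS]modnDmr modnMmr modnDmr.
case: egcdnP => //= u v Du _; rewrite (eqP co_pq) in Du.
rewrite mulnCA [(p * u)%N]mulnC Du mulnDr muln1 mulnA.
by rewrite addnCA modnMDl addnCA -mulSn prednK // mulnC addnC modnMDl.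
Qed.

(** Since idx < q, q * slot is at most p + p (q - 1) = pq. Block ends thus stay in [0, p] under
    repeated decimation. *)
Lemma slot_le r m : (r < q)%N -> (m <= p)%N -> (slot r m <= p)%N.
Proof. by move=> lt_rq le_mp; have := slotE m lt_rq; have := idx_lt r m; nia. Qed.

Lemma eq_of_pq_comb i j a b : (i < q)%N -> (j < q)%N ->
  (p * i + q * a = p * j + q * b)%N -> i = j.
Proof.
wlog le_ij : i j a b / (i <= j)%N.
  by move=> IH lt_iq lt_jq E; case/orP: (leq_total i j) => le;
    [|apply/esym]; apply: IH le _ _ _; eauto.
move=> lt_iq lt_jq E; have : (q %| p * (j - i))%N.
  by apply/dvdnP; exists (a - b)%N; rewrite mulnBr; nia.
rewrite Gauss_dvdr 1?coprime_sym // => /dvdn_leq; lia.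
Qed.

(** As p is invertible mod q, the exponents m + p i with i < q meet each residue class once, so one
    monomial survives. *)
Lemma dec_Xm_geom_comp r m : (r < q)%N ->
  dec q r ('X^m * (geom q \Po 'X^p)) = 'X^(slot r m).
Proof.
move=> lt_rq; apply/polyP => k; rewrite coef_dec // coefXn.
have -> : geom q \Po 'X^p = \sum_(i < q) 'X^(p * i).
  rewrite rmorph_sum; apply: eq_bigr => i _.
  by rewrite rmorphXn /= comp_polyX exprM.
have Eslot := slotE m lt_rq; have lt_idx := idx_lt r m.
have exp_eq (i : 'I_q) :
    (r + q * k == m + p * i)%N = (k == slot r m) && (i == Ordinal lt_idx).
  rewrite -val_eqE /=; apply/eqP/andP => [Eki | [/eqP-> /eqP->] //].
  have lt_iq := ltn_ord i.
  suff Ei : i = idx r m :> nat.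
    by rewrite Ei eqxx; split=> //; move: Eki; rewrite Ei Eslot; nia.
  by apply: (eq_of_pq_comb (a := slot r m) (b := k)) => //; lia.
rewrite mulr_sumr coef_sum; under eq_bigr do rewrite -exprD coefXn exp_eq.
case: eqP => _ /=; last by rewrite big1.
by rewrite (bigD1 (Ordinal lt_idx)) //= eqxx big1 ?addr0 // => i /negbTE->.
Qed.

(** A factor X - 1 outside [dec] is X^q - 1 = (X - 1) Phi_q inside. There X - 1 turns the block into
    X^b - X^a, and Phi_q Phi_pq is a sum of powers of X^p. *)
Lemma dec_gapR r a b : (r < q)%N ->
  dec q r (gap a b * 'Phi_(p * q)) = gap (slot r a) (slot r b).
Proof.
move=> lt_rq; apply: (mulfI XsubC1_neq0); rewrite gapE -!dec_Xm_geom_comp //.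
rewrite -decN // -decD // -mulrBl -gapE -Cyclotomic_q_pq //.
rewrite (Cyclotomic_prime q_prime) mulrC -dec_comp // rmorphB rmorph1 /= comp_polyX.
by rewrite -geomE; congr dec; ring.
Qed.

Local Notation W := (cyc_word p q 1).
Local Notation h w := (height (W w)).
Local Notation letterQ := (true, false).
Local Notation letterR := (false, true).

Lemma cyc_word_cons a c w :
  W ((a, c) :: w) = 'Phi_q ^+ a * 'Phi_(p * q) ^+ c * (W w \Po 'X^q).
Proof. by rewrite /= cyc_word_comp // expn1. Qed.

Lemma dec1 r : (r < q)%N -> dec q r 1 = (r == 0%N)%:R.
Proof.
move=> lt_rq; apply/polyP => k; rewrite coef_dec // coef1.
case: r lt_rq => [|r] _ /=; last by rewrite coef0.
by rewrite coef1 add0n muln_eq0 eqn0Ngt q_gt0.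
Qed.

Lemma height_nat_boolM (b : bool) P : (height (b%:R * P) <= height P)%N.
Proof.
case: b; rewrite ?mul1r // mul0r; apply: height_leP => i.
by rewrite coef0.
Qed.

Lemma dec_geom_q r : (r < q)%N -> dec q r (geom q) = 1.
Proof.
move=> lt_rq; apply/polyP => k; rewrite coef_dec // coef_geom coef1.
case: k => [|k]; first by rewrite muln0 addn0 lt_rq.
by case: ltnP => //; nia.
Qed.

(** The premise [c ==> a] leaves out only Phi_pq alone; the other letters decimate to monomials or
    0. *)
Lemma height_cons_le a c w : (c ==> a) -> (h ((a, c) :: w) <= h w)%N.
Proof.
move=> ca; rewrite cyc_word_cons; apply: height_dec_le => // r lt_rq.
case: c ca => [/= -> | _].
  have := dec_Xm_geom_comp 0 lt_rq; rewrite expr0 mul1r => dec_T.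
  by rewrite !expr1 Cyclotomic_q_pq // dec_T heightXnM.
case: a; rewrite expr0 mulr1 ?expr0 ?expr1.
  by rewrite (Cyclotomic_prime q_prime) dec_geom_q // mul1r.
by rewrite dec1 // height_nat_boolM.
Qed.

Lemma height_gapM_consR a b w N :
    (forall r, (r < q)%N -> (height (gap (slot r a) (slot r b) * W w) <= N)%N) ->
  (height (gap a b * W (letterR :: w)) <= N)%N.
Proof.
move=> leN; rewrite cyc_word_cons expr0 mul1r expr1 mulrA.
by apply: height_dec_le => // r lt_rq; rewrite dec_gapR // leN.
Qed.

Lemma height_consR w N :
    (forall r, (r < q)%N -> (height (gap (slot r 0) (slot r 1) * W w) <= N)%N) ->
  (h (letterR :: w) <= N)%N.
Proof. by move=> leN; rewrite -[W _]mul1r -gap01; apply: height_gapM_consR. Qed.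

Lemma height_gapM_cons a b c d w : (d ==> c) ->
  (height (gap a b * W ((c, d) :: w)) <= dist a b * h w)%N.
Proof.
by move=> dc; rewrite (leq_trans (height_gapM _ _ _)) // leq_mul2l height_cons_le ?orbT.
Qed.

Lemma height_gapM_consQ a b w : (a <= q)%N -> (b <= q)%N ->
  (dist a b * h w <= height (gap a b * W (letterQ :: w)))%N.
Proof.
move=> le_aq le_bq; rewrite cyc_word_cons expr0 mulr1 expr1 mulrA.
by rewrite (Cyclotomic_prime q_prime) height_gap_geom_ge.
Qed.

Lemma height_gapM_consR_ge a b w r : (r < q)%N ->
  (height (gap (slot r a) (slot r b) * W w) <= height (gap a b * W (letterR :: w)))%N.
Proof.
move=> lt_rq; rewrite cyc_word_cons expr0 mul1r expr1 mulrA -dec_gapR //.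
exact: height_dec_ge.
Qed.

Lemma slot_le_q r m : (r < q)%N -> (m <= p)%N -> (slot r m <= q)%N.
Proof. by move=> lt_rq le_mp; rewrite (leq_trans (slot_le lt_rq le_mp)) // ltnW. Qed.

Lemma dist_slot r a b : (r < q)%N -> (a <= p)%N -> (b <= p)%N ->
  (dist (slot r a) (slot r b) <= p)%N.
Proof.
move=> lt_rq le_ap le_bp; rewrite /dist.
by have := slot_le lt_rq le_ap; have := slot_le lt_rq le_bp; lia.
Qed.

(** * Words of at most four letters *)

Local Notation H := (h [:: letterR; letterQ]).
Local Notation H2 := (h [:: letterR; letterR; letterQ]).

Lemma height_nil : h [::] = 1%N.
Proof. exact: height1. Qed.

(** Along the class of [r], Phi_pq gives a block of length [dist (slot r 0) (slot r 1)], and Phi_q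
    then realises this length as a factor. *)
Lemma height_RQ_ge r w : (r < q)%N ->
  (dist (slot r 0) (slot r 1) * h w <= h [:: letterR, letterQ & w])%N.
Proof.
move=> lt_rq; rewrite -[W [:: _, _ & _]]mul1r -gap01.
rewrite (leq_trans _ (height_gapM_consR_ge _ _ _ lt_rq)) //.
by rewrite height_gapM_consQ // slot_le_q.
Qed.

Lemma dist_le_H r : (r < q)%N -> (dist (slot r 0) (slot r 1) <= H)%N.
Proof. by move=> lt_rq; have := height_RQ_ge [::] lt_rq; rewrite height_nil muln1. Qed.

Lemma dist_le_H2 r r' : (r < q)%N -> (r' < q)%N ->
  (dist (slot r' (slot r 0)) (slot r' (slot r 1)) <= H2)%N.
Proof.
move=> lt_rq lt_r'q; rewrite -[W [:: _, _ & _]]mul1r -gap01.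
rewrite (leq_trans _ (height_gapM_consR_ge _ _ _ lt_rq)) //.
rewrite (leq_trans _ (height_gapM_consR_ge _ _ _ lt_r'q)) //.
have := @height_gapM_consQ (slot r' (slot r 0)) (slot r' (slot r 1)) [::].
by rewrite height_nil muln1; apply; rewrite slot_le_q // slot_le.
Qed.

(* The decimations of Phi_pq along the classes 0 and 1 are blocks whose lengths
   have sum p. *)
Lemma leq_p_2H : (p <= 2 * H)%N.
Proof.
have lt_1q : (1 < q)%N by apply: prime_gt1.
have := dist_le_H q_gt0; have := dist_le_H lt_1q; rewrite /dist.
have := slotE 0 q_gt0; have := slotE 1 q_gt0.
have := slotE 0 lt_1q; have := slotE 1 lt_1q.
have := idx_lt 0 0; have := idx_lt 0 1; have := idx_lt 1 0; have := idx_lt 1 1.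
move: (idx 0 0) (idx 0 1) (idx 1 0) (idx 1 1) => i00 i01 i10 i11.
move: (slot 0 0) (slot 0 1) (slot 1 0) (slot 1 1) => s00 s01 s10 s11.
move: H => n lt11 lt10 lt01 lt00 E11 E10 E01 E00.
(* Adding [slotE] at (r, m) = (0, 1) and (1, 0) gives p (i01 + i10) = q (s01 + s10). *)
have : (p %| q * (s01 + s10))%N by apply/dvdnP; exists (i01 + i10)%N; nia.
have s00_0 : s00 = 0%N.
  have i00_0 : i00 = 0%N by apply: (@eq_of_pq_comb i00 0 0 s00) => //; lia.
  by nia.
have s11_0 : s11 = 0%N.
  have i11_0 : i11 = 0%N by apply: (@eq_of_pq_comb i11 0 0 s11) => //; lia.
  by nia.
rewrite Gauss_dvdr // => /dvdn_leq; rewrite s00_0 s11_0.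
suff : (0 < s01)%N by lia.
by case: s01 E01 => // E01; lia.
Qed.

(** p > 2 and p <= 2H force H >= 2, hence 2H <= H * H. *)
Lemma leq_p_HH : (p <= H * H)%N.
Proof. by have := leq_p_2H; nia. Qed.

Lemma H_gt0 : (0 < H)%N.
Proof. by have := leq_p_2H; lia. Qed.

Lemma height_word1 w : (size w <= 1)%N -> (h w <= 1)%N.
Proof.
case: w => [|[a c] [|//]] _; first by rewrite height_nil.
case ca: (c ==> a); first by rewrite (leq_trans (height_cons_le _ ca)) ?height_nil.
case: c a ca => [] [] // _; apply: height_consR => r lt_rq.
by rewrite [gap _ _ * _]mulr1 height_gap.
Qed.

Lemma height_gapM_word1 a b w : (size w <= 1)%N ->
  (height (gap a b * W w) <= dist a b)%N.
Proof.
move/height_word1 => le1; rewrite (leq_trans (height_gapM _ _ _)) //.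
by rewrite -[leqRHS]muln1 leq_mul2l le1 orbT.
Qed.

Lemma height_word2 w : (size w <= 2)%N -> (h w <= H)%N.
Proof.
case: w => [|[a c] w] sz_w; first by rewrite height_nil H_gt0.
have {}sz_w : (size w <= 1)%N := sz_w.
case ca: (c ==> a).
  by rewrite (leq_trans (height_cons_le _ ca)) // (leq_trans (height_word1 sz_w)) ?H_gt0.
case: c a ca => [] [] // _; apply: height_consR => r lt_rq.
exact: leq_trans (height_gapM_word1 _ _ sz_w) (dist_le_H lt_rq).
Qed.

(** After an initial Phi_pq, a different second letter leaves a block length at most H times a
    height at most 1; a second Phi_pq yields block lengths bounded by H2. *)
Lemma height_word3 w : (size w <= 3)%N -> (h w <= maxn H2 H)%N.
Proof.
case: w => [|[a c] w] sz_w; first by rewrite height_nil leq_max H_gt0 orbT.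
have {}sz_w : (size w <= 2)%N := sz_w.
case ca: (c ==> a).
  by rewrite (leq_trans (height_cons_le _ ca)) // leq_max (height_word2 sz_w) orbT.
case: c a ca => [] [] // _; apply: height_consR => r lt_rq.
case: w sz_w => [|[a c] w] sz_w.
  by rewrite [gap _ _ * _]mulr1 (leq_trans (height_gap _ _)) // leq_max H_gt0 orbT.
have {}sz_w : (size w <= 1)%N := sz_w.
case ca: (c ==> a).
  rewrite leq_max orbC (leq_trans _ (dist_le_H lt_rq)) //.
  rewrite (leq_trans (height_gapM_cons _ _ _ ca)) // -[leqRHS]muln1.
  by rewrite leq_mul2l height_word1 ?orbT.
case: c a ca => [] [] // _; apply: height_gapM_consR => r' lt_r'q.
by rewrite leq_max (leq_trans (height_gapM_word1 _ _ sz_w)) ?dist_le_H2.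
Qed.

Lemma dist_le_p r r' : (r < q)%N -> (r' < q)%N ->
  (dist (slot r' (slot r 0)) (slot r' (slot r 1)) <= p)%N.
Proof. by move=> lt_rq lt_r'q; rewrite dist_slot ?slot_le // ltnW. Qed.

Lemma H_le_p : (H <= p)%N.
Proof.
apply: height_consR => r lt_rq.
by rewrite (leq_trans (height_gapM_word1 _ _ _)) // dist_slot // prime_gt0.
Qed.

Lemma H2_le_p : (H2 <= p)%N.
Proof.
apply: height_consR => r lt_rq; apply: height_gapM_consR => r' lt_r'q.
by rewrite (leq_trans (height_gapM_word1 _ _ _)) // dist_le_p.
Qed.

(** After an initial Phi_pq, a different second letter leaves a block length and a word of two
    letters, each worth at most H. If Phi_pq is repeated, the bound is a single block length, at
    most p <= H * H. *)
Lemma height_word4 w : (size w <= 4)%N -> (h w <= H * H)%N.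
Proof.
have HH_gt0 : (0 < H * H)%N by rewrite muln_gt0 H_gt0.
have le_maxH : (maxn H2 H <= H * H)%N.
  by rewrite geq_max !(leq_trans _ leq_p_HH) ?H_le_p ?H2_le_p.
case: w => [|[a c] w] sz_w; first by rewrite height_nil.
have {}sz_w : (size w <= 3)%N := sz_w.
case ca: (c ==> a).
  by rewrite (leq_trans (height_cons_le _ ca)) // (leq_trans (height_word3 sz_w)).
case: c a ca => [] [] // _; apply: height_consR => r lt_rq.
case: w sz_w => [|[a c] w] sz_w.
  by rewrite [gap _ _ * _]mulr1 (leq_trans (height_gap _ _)).
have {}sz_w : (size w <= 2)%N := sz_w.
case ca: (c ==> a).
  rewrite (leq_trans (height_gapM_cons _ _ _ ca)) //.
  by rewrite leq_mul ?dist_le_H ?height_word2.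
case: c a ca => [] [] // _; apply: height_gapM_consR => r' lt_r'q.
have le_p := dist_le_p lt_rq lt_r'q.
case: w sz_w => [|[a c] w] sz_w.
  by rewrite [gap _ _ * _]mulr1 (leq_trans (height_gap _ _)).
have {}sz_w : (size w <= 1)%N := sz_w.
case ca: (c ==> a).
  rewrite (leq_trans (height_gapM_cons _ _ _ ca)) // (leq_trans _ leq_p_HH) //.
  by rewrite -[leqRHS]muln1 leq_mul ?height_word1.
case: c a ca => [] [] // _; apply: height_gapM_consR => r'' lt_r''q.
rewrite (leq_trans (height_gapM_word1 _ _ sz_w)) // (leq_trans _ leq_p_HH) //.
by rewrite dist_slot // slot_le // slot_le // ltnW.
Qed.

Lemma height_RQRQ : h [:: letterR; letterQ; letterR; letterQ] = (H * H)%N.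
Proof.
(* Dividing by H turns the lower bound into an upper bound on one factor H, which can be checked on
   block lengths. *)
apply/eqP; rewrite eqn_leq height_word4 // andTb -leq_divRL ?H_gt0 //.
apply: height_consR => r lt_rq; rewrite leq_divRL ?H_gt0 //.
rewrite (leq_trans _ (height_RQ_ge _ lt_rq)) // leq_mul2r.
by rewrite height_gapM_word1 ?orbT.
Qed.

(* When the two differences have the same sign, their sum is at most
   (p (q - 1) + 2) / q; otherwise it is a multiple of p smaller than 2 p. *)
Lemma dist_slot012 r : (r < q)%N ->
  (dist (slot r 0) (slot r 1) + dist (slot r 1) (slot r 2) <= p)%N.
Proof.
move=> lt_rq; rewrite /dist.
have := slotE 0 lt_rq; have := slotE 1 lt_rq; have := slotE 2 lt_rq.
have := idx_lt r 0; have := idx_lt r 1; have := idx_lt r 2.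
move: (idx r 0) (idx r 1) (idx r 2) => x y z.
move: (slot r 0) (slot r 1) (slot r 2) => a b c ltz lty ltx Ec Eb Ea.
have co_qp : coprime q p by rewrite coprime_sym.
have [le_x le_y le_z] : [/\ p * x + p <= p * q, p * y + p <= p * q
    & p * z + p <= p * q]%N by rewrite -!mulnSr !leq_mul2l ltx lty ltz !orbT.
have mul_le_p t n : (p * t = q * n)%N -> (t < 2 * q)%N -> (n <= p)%N.
  move=> Dn lt_t; have : (q %| p * t)%N by rewrite Dn dvdn_mulr.
  rewrite Gauss_dvdr // => /dvdnP[u Du]; rewrite Du ltn_pmul2r // in lt_t.
  have le_u1 : (u <= 1)%N by [].
  by rewrite -(leq_pmul2l q_gt0) -Dn Du mulnA [leqRHS]mulnC leq_mul2r
     -[leqRHS]muln1 leq_mul2l le_u1 !orbT.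
have [le_ba | lt_ab] := leqP b a; have [le_cb | lt_bc] := leqP c b.
- suff : (a <= c + p)%N by lia.
  by rewrite -(leq_pmul2l q_gt0); lia.
- suff : (a + c - 2 * b <= p)%N by lia.
  by apply: (mul_le_p (x + z - 2 * y)%N); rewrite ?mulnBr; lia.
- suff : (2 * b - (a + c) <= p)%N by lia.
  by apply: (mul_le_p (2 * y - (x + z))%N); rewrite ?mulnBr; lia.
- suff : (c <= a + p)%N by lia.
  by rewrite -(leq_pmul2l q_gt0); lia.
Qed.

Lemma height_Xn_sub1M n P : (height (('X^n - 1) * P) <= 2 * height P)%N.
Proof.
rewrite mulrBl mul1r mul2n -addnn (leq_trans (heightD _ _)) //.
by rewrite heightN leq_add ?heightXnM.
Qed.

Lemma dec_Xsub1 r : (r < q)%N -> dec q r ('X - 1) = (r == 1)%N%:R - (r == 0)%N%:R.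
Proof.
move=> lt_rq; rewrite decD // decN // dec1 //; congr (_ - _).
apply/polyP => k; rewrite coef_dec // coefX.
have -> : (r + q * k == 1)%N = (r == 1)%N && (k == 0)%N by case: k => [|k]; nia.
by case: (r == 1)%N; rewrite ?coef1 ?coef0.
Qed.

(** * The factors of X^p - 1 and the resulting value of [B] *)

Section LowFactors.

Variables (k N : nat).
Hypothesis le_hN : forall w, (size w <= k)%N -> (h w <= N)%N.

Let N_gt0 : (0 < N)%N.
Proof. by have := le_hN (w := [::]); rewrite height_nil; apply. Qed.

Let two_N : (2 * N <= p * N)%N.
Proof. by rewrite leq_mul2r ltnW ?orbT. Qed.

Lemma height_word_le_pN w : (size w <= k.+1)%N -> (h w <= p * N)%N.
Proof.
case: w => [|[a c] w] sz_w; first by rewrite height_nil muln_gt0 p_gt0.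
have {}sz_w : (size w <= k)%N := sz_w.
case ca: (c ==> a).
  rewrite (leq_trans (height_cons_le _ ca)) // (leq_trans (le_hN sz_w)) //.
  by rewrite leq_pmull.
case: c a ca => [] [] // _; apply: height_consR => r lt_rq.
by rewrite (leq_trans (height_gapM _ _ _)) // leq_mul ?dist_slot ?le_hN.
Qed.

(** [geom p] is the block from 0 to p, and Phi_pq sends it to blocks of length at most p. *)
Lemma height_geomM_word w : (size w <= k.+1)%N -> (height (geom p * W w) <= p * N)%N.
Proof.
rewrite -gap0n; case: w => [|[a c] w] sz_w.
  rewrite [_ * _]mulr1 (leq_trans (height_gap _ _)) //.
  by rewrite muln_gt0 p_gt0.
have {}sz_w : (size w <= k)%N := sz_w.
case ca: (c ==> a).
  rewrite (leq_trans (height_gapM_cons _ _ _ ca)) // leq_mul ?le_hN //.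
  by rewrite /dist sub0n subn0.
case: c a ca => [] [] // _; apply: height_gapM_consR => r lt_rq.
by rewrite (leq_trans (height_gapM _ _ _)) // leq_mul ?dist_slot ?le_hN.
Qed.

Lemma height_Xsub1M_word w : (size w <= k.+1)%N ->
  (height (('X - 1) * W w) <= p * N)%N.
Proof.
have le2 P : (height (('X - 1) * P) <= 2 * height P)%N by apply: (height_Xn_sub1M 1).
case: w => [|[a c] w] sz_w.
  apply: leq_trans (le2 _) _; rewrite height_nil (leq_trans _ two_N) //.
  by rewrite leq_mul2l N_gt0.
have {}sz_w : (size w <= k)%N := sz_w.
case ca: (c ==> a).
  apply: leq_trans (le2 _) _; apply: leq_trans two_N; rewrite leq_mul2l.
  by rewrite (leq_trans (height_cons_le _ ca)) ?le_hN.
case: c a ca => [] [] // _; rewrite cyc_word_cons expr0 mul1r expr1 mulrA.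
apply: height_dec_le => // r lt_rq.
(* As a difference of adjacent unit blocks, X - 1 times Phi_pq decimates to two blocks of total
   length at most p. *)
have -> : 'X - 1 = gap 1 2 - gap 0 1.
  by apply: (mulfI XsubC1_neq0); rewrite [in RHS]mulrBr !gapE; ring.
rewrite mulrBl decD // decN // !dec_gapR // mulrBl (leq_trans (heightD _ _)) //.
rewrite heightN (leq_trans (leq_add (height_gapM _ _ _) (height_gapM _ _ _))) //.
by rewrite -mulnDl leq_mul ?le_hN // addnC dist_slot012.
Qed.

(** If the first letter is Phi_pq alone, Phi_p Phi_pq is a polynomial in X^q and only X - 1 is
    decimated, to 0 or a sign, so that Phi_p costs at most p. Otherwise X^p - 1 costs at most 2. *)
Lemma height_Xp_sub1M_word w : (size w <= k.+1)%N ->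
  (height (('X - 1) * geom p * W w) <= p * N)%N.
Proof.
case: w => [|[a c] w] sz_w.
  rewrite geomE (leq_trans (height_Xn_sub1M _ _)) // height_nil (leq_trans _ two_N) //.
  by rewrite leq_mul2l N_gt0.
have {}sz_w : (size w <= k)%N := sz_w.
case ca: (c ==> a).
  rewrite geomE (leq_trans (height_Xn_sub1M _ _)) // (leq_trans _ two_N) //.
  by rewrite leq_mul2l (leq_trans (height_cons_le _ ca)) ?le_hN.
case: c a ca => [] [] // _; rewrite cyc_word_cons expr0 mul1r expr1.
rewrite -mulrA [geom p * _]mulrA -(Cyclotomic_prime p_prime) Cyclotomic_p_pq //.
rewrite -rmorphM; apply: height_dec_le => // r lt_rq.
have le_pN : (height (geom p * W w) <= p * N)%N.
  by rewrite (leq_trans (height_geomM _ _)) // leq_mul2l le_hN ?orbT.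
rewrite dec_Xsub1 //; case: r lt_rq => [|[|r]] _ /=.
- by rewrite sub0r mulN1r heightN.
- by rewrite subr0 mul1r.
- by rewrite subr0 mul0r; apply: height_leP => i; rewrite coef0.
Qed.

Lemma cyc_word0_cons a c w :
  cyc_word p q 0 ((a, c) :: w) = ('X - 1) ^+ a * geom p ^+ c * W w.
Proof. by rewrite /= !expn0 muln1 Cyclotomic1 (Cyclotomic_prime p_prime). Qed.

(** Here [N] bounds the words of at most k letters and [v] attains it; index 0 and the first letter
    supply the factor p. *)
Lemma B_pq_exp v : size v = k -> h v = N -> B (p * q ^ k.+1) = (p * N)%N.
Proof.
move=> sz_v Dhv; have n_gt0 : (0 < p * q ^ k.+1)%N.
  by rewrite muln_gt0 p_gt0 expn_gt0 q_gt0.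
have [[f [g Dfg] <-] f_max] := BP n_gt0.
apply/eqP; rewrite eqn_leq; apply/andP; split.
  move: Dfg; rewrite Xn_sub1_cyc_word // mulrC => /esym/cyc_word_divisor.
  case=> // -[|[a c] w] // [sz_w] Df.
  have -> : height f = height (cyc_word p q 0 ((a, c) :: w)).
    by case: Df => ->; rewrite ?heightN.
  rewrite cyc_word0_cons; have le_w : (size w <= k.+1)%N by rewrite sz_w.
  case: a c {Df} => [] []; rewrite !(expr0, expr1, mulr1, mul1r).
  - exact: height_Xp_sub1M_word.
  - exact: height_Xsub1M_word.
  - exact: height_geomM_word.
  - exact: height_word_le_pN.
(* At index 0 the letter [letterR] is Phi_p, a block of length p, which Phi_q at index 1 realises as
   a factor p. *)
pose w := letterR :: letterQ :: v.
apply: leq_trans (f_max (height (cyc_word p q 0 w)) _).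
  rewrite cyc_word0_cons expr0 mul1r expr1 -gap0n -Dhv.
  apply: leq_trans (height_gapM_consQ v (leq0n q) (ltnW p_lt_q)).
  by rewrite leq_mul2r /dist sub0n subn0 leqnn orbT.
exists (cyc_word p q 0 w) => //=.
have [f' Df'] := cyc_word_dvd p q 0 w.
by exists f'; rewrite -Df' /= sz_v Xn_sub1_cyc_word.
Qed.

End LowFactors.

End Words.

Theorem theorem1p7 (p q : nat) (p_prime : prime p) (q_prime : prime q)
    (p_odd : odd p) (q_odd : odd q) (p_lt_q : (p < q)%N) :
  B (p * q ^ 4)%N =
    maxn (p * height ('Phi_(p * q) * 'Phi_(p * q ^ 2) * 'Phi_(q ^ 3)))
         (p * height ('Phi_(p * q) * 'Phi_(q ^ 2)))
  /\
  B (p * q ^ 5)%N =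
    (p * height ('Phi_(p * q) * 'Phi_(q ^ 2)) ^ 2)%N.
Proof.
have p_gt2 : (2 < p)%N by rewrite odd_prime_gt2.
pose Q := (true, false); pose R := (false, true); pose I := (false, false).
have -> : 'Phi_(p * q) * 'Phi_(q ^ 2) = cyc_word p q 1 [:: R; Q].
  by rewrite /= !(expr0, expr1, mulr1, mul1r) expn1.
have -> : 'Phi_(p * q) * 'Phi_(p * q ^ 2) * 'Phi_(q ^ 3) = cyc_word p q 1 [:: R; R; Q].
  by rewrite /= !(expr0, expr1, mulr1, mul1r) expn1 mulrA.
rewrite -maxnMr -mulnn; split.
  have le3 := height_word3 p_prime q_prime p_gt2 p_lt_q.
  set H2 := height (cyc_word p q 1 [:: R; R; Q]) in le3 *.
  set H := height (cyc_word p q 1 [:: R; Q]) in le3 *.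
  have [le_H | lt_H] := leqP H H2.
    by apply: (@B_pq_exp p q p_prime q_prime p_gt2 p_lt_q 3 _ _ [:: R; R; Q]) => // w /le3;
      rewrite (maxn_idPl le_H).
  (* The trivial letter [I] pads the word to three letters without changing the polynomial. *)
  apply: (@B_pq_exp p q p_prime q_prime p_gt2 p_lt_q 3 _ _ [:: R; Q; I]) => //.
    by move=> w /le3; rewrite (maxn_idPr (ltnW lt_H)).
  by rewrite /H /= !(expr0, mulr1).
apply: (@B_pq_exp p q p_prime q_prime p_gt2 p_lt_q 4 _ _ [:: R; Q; R; Q]) => //.
  exact: height_word4.
exact: height_RQRQ.
Qed.
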